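(* Let $\mathscr{A}$ be a $C^*$-algebra, let $\mathscr{X}$ be a Hilbert $\mathscr{A}$-module, and let $x,y\in\mathscr{X}$. Then \[ \rho_{+}(x,y)=\max\Big\{\operatorname{Re}\varphi(\langle x,y\rangle):\ \varphi\in\Omega_x\Big\}, \] and in particular the supremum over $\Omega_x$ is attained.
   Context: A Hilbert $\mathscr{A}$-module is a right $\mathscr{A}$-module $\mathscr{X}$ with an $\mathscr{A}$-valued inner product $\langle\cdot,\cdot\rangle$, linear in the second variable and conjugate-linear in the first, with $\langle x,ya\rangle=\langle x,y\rangle a$, $\langle x,y\rangle^*=\langle y,x\rangle$, $\langle x,x\rangle\ge 0$ with equality iff $x=0$, complete for the norm $\|x\|=\|\langle x,x\rangle\|^{1/2}$. A state on $\mathscr{A}$ is a positive linear functional of norm one; $\mathcal{S}(\mathscr{A})$ denotes the set of states. For $x\in\mathscr{X}$, $\Omega_x:=\{\varphi\in\mathcal{S}(\mathscr{A}):\varphi(\langle x,x\rangle)=\|x\|^2\}$ (this set is nonempty). For a normed space $X$ and $x,y\in X$, the norm derivatives are $\rho_{\pm}(x,y):=\lim_{t\to0^{\pm}}\frac{\|x+ty\|^2-\|x\|^2}{2t}$. *)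

(* Defs.v *)
From mathcomp Require Import all_boot all_order all_algebra.
From mathcomp Require Import all_classical all_reals topology normedtype.
From mathcomp Require Import complex.
Set Implicit Arguments.
Unset Strict Implicit.
Unset Printing Implicit Defensive.
Import Order.TTheory GRing.Theory Num.Theory numFieldNormedType.Exports.
Local Open Scope ring_scope.
Local Open Scope classical_set_scope.

Section CStar.
Variable R : realType.
Local Notation C := R[i].
Variables (A : lmodType C) (mul : A -> A -> A) (star : A -> A) (nA : A -> R).

Definition cauchy_seq {T : zmodType} (n : T -> R) (u : nat -> T) : Prop :=
  forall e : R, 0 < e -> exists N : nat, forall m k : nat,
    (N <= m)%N -> (N <= k)%N -> n (u m - u k) < e.

Definition converges_to {T : zmodType} (n : T -> R) (u : nat -> T) (l : T) : Prop :=
  forall e : R, 0 < e -> exists N : nat, forall m : nat, (N <= m)%N -> n (u m - l) < e.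

Record is_cstar_algebra : Prop := {
  mul_linl : forall (c : C) a b d, mul (c *: a + b) d = c *: mul a d + mul b d;
  mul_linr : forall (c : C) a b d, mul d (c *: a + b) = c *: mul d a + mul d b;
  mul_assoc : forall a b d, mul a (mul b d) = mul (mul a b) d;
  star_semilin : forall (c : C) a b, star (c *: a + b) = conjc c *: star a + star b;
  star_invol : forall a, star (star a) = a;
  star_mul : forall a b, star (mul a b) = mul (star b) (star a);
  nA_ge0 : forall a, 0 <= nA a;
  nA_eq0 : forall a, nA a = 0 -> a = 0;
  nA_scale : forall (c : C) a, nA (c *: a) = Normc.normc c * nA a;
  nA_triangle : forall a b, nA (a + b) <= nA a + nA b;
  nA_submul : forall a b, nA (mul a b) <= nA a * nA b;
  nA_cstar : forall a, nA (mul (star a) a) = nA a ^+ 2;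
  nA_complete : forall u : nat -> A, cauchy_seq nA u -> exists l, converges_to nA u l
}.

(* Spectrum via the unitization: for l != 0, l is in the spectrum of a iff
   l - a is not invertible in the unitization, i.e. iff l^-1 a is not
   quasi-invertible (1 - c invertible with inverse 1 - b iff c + b - cb = 0 =
   c + b - bc).  0 always belongs to the spectrum computed in the unitization. *)
Definition quasi_invertible (a : A) : Prop :=
  exists b : A, a + b - mul a b = 0 /\ a + b - mul b a = 0.

Definition in_spectrum (a : A) (l : C) : Prop :=
  l = 0 \/ (l != 0 /\ ~ quasi_invertible (l^-1 *: a)).

(* a >= 0 : a is self-adjoint with spectrum in [0, +oo)
   (in R[i], 0 <= l means l is real and nonnegative). *)
Definition cstar_positive (a : A) : Prop :=
  star a = a /\ forall l : C, in_spectrum a l -> 0 <= l.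

Definition linear_functional (phi : A -> C) : Prop :=
  forall (c : C) a b, phi (c *: a + b) = c * phi a + phi b.

Definition positive_functional (phi : A -> C) : Prop :=
  linear_functional phi /\ forall a, cstar_positive a -> 0 <= phi a.

Definition functional_norm (phi : A -> C) : R :=
  sup [set r : R | exists a : A, nA a <= 1 /\ r = Normc.normc (phi a)].

Definition is_state (phi : A -> C) : Prop :=
  positive_functional phi /\ functional_norm phi = 1.

Variables (X : lmodType C) (act : X -> A -> X) (ip : X -> X -> A).

Definition hnorm (x : X) : R := Num.sqrt (nA (ip x x)).

Record is_hilbert_module : Prop := {
  act_addl : forall x y a, act (x + y) a = act x a + act y a;
  act_addr : forall x a b, act x (a + b) = act x a + act x b;
  act_mul : forall x a b, act x (mul a b) = act (act x a) b;
  act_scalel : forall (c : C) x a, act (c *: x) a = c *: act x a;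
  act_scaler : forall (c : C) x a, act x (c *: a) = c *: act x a;
  ip_linr : forall (c : C) x y z, ip x (c *: y + z) = c *: ip x y + ip x z;
  ip_semilinl : forall (c : C) x y z, ip (c *: x + y) z = conjc c *: ip x z + ip y z;
  ip_act : forall x y a, ip x (act y a) = mul (ip x y) a;
  ip_star : forall x y, star (ip x y) = ip y x;
  ip_pos : forall x, cstar_positive (ip x x);
  ip_def : forall x, ip x x = 0 -> x = 0;
  hnorm_complete : forall u : nat -> X, cauchy_seq hnorm u -> exists l, converges_to hnorm u l
}.

Definition Omega (x : X) : set (A -> C) :=
  [set phi | is_state phi /\ phi (ip x x) = real_complex R (hnorm x ^+ 2)].

Definition rho_quot (x y : X) (t : R) : R :=
  (hnorm (x + real_complex R t *: y) ^+ 2 - hnorm x ^+ 2) / (2 * t).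

End CStar.

(* Main.v *)
(* The norm is itself a sublinear functional N on A viewed as a real vector space.
   With a = <x,x> and b = <x,y> + <y,x>, twice rho_+(x,y) is the directional
   derivative N_a(b) = inf_{t >= 0} N(b + ta) - t N(a), the term t^2 <y,y> being
   negligible.  N_a is again sublinear, so some real linear f <= N_a has
   f(b) = N_a(b).  As f <= N and f(a) = N(a), f extends to a complex functional of
   norm one; it is positive because N(ta - h) <= t N(a) for h >= 0 and large t.
   Conversely a state in Omega_x bounds the difference quotients from below.

   The only spectral input is that a >= 0 implies |2ad - N(a)d| <= N(a)|d|, i.e. that
   the selfadjoint operator u : d |-> 2ad - N(a)d has norm at most N(a).  This is
   obtained without analytic functions.  Comparing (1 + iu)^2 with (1 + iu)(1 - iu)
   gives 2|ud| <= |(1 + u^2)d|; multiplying along 1 - u^(2^(n+1)) =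
   (1 - u^2)(1 + u^2)(1 + u^4)... gives 2^n |u^(2^n - 1) (1 - u^2) d| <=
   |(1 - u^(2^(n+1))) d|.  Hence if |u| <= 1 and 1 - u^2 is bounded below then
   |u| < 1, so the norm of u can only be a value q at which q^2 - u^2 is not
   bounded below. *)
From HB Require Import structures.
Require Import Defs.
From mathcomp Require Import all_boot all_order all_algebra.
From mathcomp Require Import all_classical all_reals topology normedtype.
From mathcomp Require Import complex.
From mathcomp Require Import ring lra.
Import Order.TTheory GRing.Theory Num.Theory numFieldNormedType.Exports.
Set Implicit Arguments.
Unset Strict Implicit.
Local Open Scope ring_scope.
Local Open Scope classical_set_scope.

(** * Sublinear functionals and linear minorants *)

Section Sublinear.
Context {R : realType} {V : lmodType R[i]}.
Implicit Types (p q : V -> R) (x y v : V) (t : R).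
Local Notation "t *:r x" := (real_complex R t *: x) (at level 40).

(** Homogeneity is asked as an inequality only: scaling back by the inverse gives equality, and for
    infima this is the bound that is checked directly. *)
Definition sublinear q :=
  (forall x y, q (x + y) <= q x + q y) /\
  (forall t x, 0 < t -> q (t *:r x) <= t * q x).

Definition real_linear (f : V -> R) :=
  (forall x y, f (x + y) = f x + f y) /\ (forall t x, f (t *:r x) = t * f x).

Lemma real_scale1 x : 1 *:r x = x.
Proof. by rewrite rmorph1 scale1r. Qed.

Lemma real_scaleA s t x : s *:r (t *:r x) = (s * t) *:r x.
Proof. by rewrite scalerA -rmorphM. Qed.

Lemma real_scaleDl s t x : (s + t) *:r x = s *:r x + t *:r x.
Proof. by rewrite rmorphD scalerDl. Qed.

Lemma real_scale0 x : 0 *:r x = 0.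
Proof. by rewrite rmorph0 scale0r. Qed.

Lemma real_scaleN t x : (- t) *:r x = - (t *:r x).
Proof. by rewrite rmorphN scaleNr. Qed.

Lemma sublinearZ q t x : sublinear q -> 0 < t -> q (t *:r x) = t * q x.
Proof.
move=> [_ qZ] t0; apply/eqP; rewrite eq_le qZ//=.
have ti0 : 0 < t^-1 by rewrite invr_gt0.
have := qZ _ (t *:r x) ti0.
rewrite real_scaleA mulVf ?gt_eqF// real_scale1.
by rewrite -(ler_pM2l t0) mulrA divff ?gt_eqF// mul1r.
Qed.

Lemma sublinear0 q : sublinear q -> q 0 = 0.
Proof.
move=> qs; have := sublinearZ (t := 2) 0 qs (ltr0n _ _).
by rewrite scaler0; lra.
Qed.

Lemma sublinearN q x : sublinear q -> - q (- x) <= q x.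
Proof.
move=> qs; have := qs.1 x (- x); rewrite subrr sublinear0//; lra.
Qed.

Lemma real_linearN f x : real_linear f -> f (- x) = - f x.
Proof. by case=> _ fZ; rewrite -(real_scale1 x) -real_scaleN !fZ mulN1r mul1r. Qed.

(* The directional derivative at [v] of the sublinear functional [q]. *)
Definition tilt q v x := inf [set r | exists2 t, 0 <= t & r = q (x + t *:r v) - t * q v].

Lemma tilt_le q v t x : sublinear q -> 0 <= t ->
  tilt q v x <= q (x + t *:r v) - t * q v.
Proof.
move=> qs t0; apply: ge_inf; last by exists t.
(* This lower bound makes the infimum genuine: apply subadditivity to [s v = (x + s v) + (- x)]. *)
exists (- q (- x)) => _ [s s0 ->].
have h : q (s *:r v) = s * q v.
  move: s0; rewrite le_eqVlt => /orP[/eqP<-|s0]; last exact: sublinearZ.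
  by rewrite real_scale0 sublinear0// mul0r.
have := qs.1 (x + s *:r v) (- x).
rewrite addrAC subrr add0r h; lra.
Qed.

Lemma le_tilt q v x m : (forall t, 0 <= t -> m <= q (x + t *:r v) - t * q v) ->
  m <= tilt q v x.
Proof.
move=> h; apply: lb_le_inf; first by exists (q (x + 0 *:r v) - 0 * q v); exists 0.
by move=> _ [t t0 ->]; exact: h.
Qed.

Lemma tilt_le_self q v x : sublinear q -> tilt q v x <= q x.
Proof.
by move=> /(@tilt_le _ v 0 x)/(_ (lexx _)); rewrite real_scale0 addr0 mul0r subr0.
Qed.

Lemma tilt_sublinear q v : sublinear q -> sublinear (tilt q v).
Proof.
move=> qs; split=> [x y|t x t0].
  (* Parameters [t] for [x] and [s] for [y] combine to [t + s] for [x + y]. *)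
  rewrite -lerBlDr; apply: le_tilt => t t0.
  rewrite lerBlDr -lerBlDl; apply: le_tilt => s s0.
  have := tilt_le v (x + y) qs (addr_ge0 t0 s0).
  have := qs.1 (x + t *:r v) (y + s *:r v).
  rewrite addrACA -real_scaleDl; lra.
rewrite -ler_pdivrMl//; apply: le_tilt => s s0.
rewrite ler_pdivrMl//.
have := tilt_le v (t *:r x) qs (mulr_ge0 (ltW t0) s0).
rewrite -real_scaleA -scalerDr (sublinearZ _ qs)//; lra.
Qed.

(** Domination at [- v] with parameter 1 reads [- f v <= q 0 - q v]. *)
Lemma le_tilt_linear f q v x : sublinear q -> real_linear f ->
  (forall z, f z <= tilt q v z) -> f v = q v.
Proof.
move=> qs fl fq; apply/eqP; rewrite eq_le (le_trans (fq v) (tilt_le_self _ _ qs))/=.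
have := le_trans (fq (- v)) (tilt_le v (- v) qs (@ler01 R)).
rewrite real_scale1 addNr sublinear0// real_linearN//; lra.
Qed.

(* A minimal sublinear functional [q] satisfies [q <= tilt q v] for every [v],
   which at [t = 1] is superadditivity. *)
Lemma minimal_sublinear_linear q : sublinear q ->
  (forall q', sublinear q' -> (forall x, q' x <= q x) -> q' = q) -> real_linear q.
Proof.
move=> qs qmin.
have qD x y : q (x + y) = q x + q y.
  apply/eqP; rewrite eq_le qs.1/=.
  have := tilt_le y x qs ler01.
  rewrite (qmin _ (tilt_sublinear y qs)) ?real_scale1; last by move=> z; exact: tilt_le_self.
  lra.
have qN x : q (- x) = - q x by apply/eqP; rewrite -subr_eq0 opprK -qD addNr sublinear0.
split=> // t x; have [t0|t0|->] := ltgtP t 0.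
- by rewrite -[t]opprK real_scaleN qN sublinearZ ?oppr_gt0// !mulNr.
- exact: sublinearZ.
- by rewrite real_scale0 mul0r sublinear0.
Qed.

(** Zorn's lemma on the sublinear functionals below [p], ordered downwards: a chain is bounded by
    its pointwise infimum, and a maximal element is a minimal functional, hence linear. *)
Lemma exists_linear_le p : sublinear p ->
  exists2 f, real_linear f & forall x, f x <= p x.
Proof.
move=> ps.
pose T := {q : V -> R | sublinear q /\ forall x, q x <= p x}.
pose le_T (q1 q2 : T) := `[< forall x, sval q2 x <= sval q1 x >].
have [|q1 q2 q3|[q1 q1P] [q2 q2P]|C Ctot|[q [qs qp]] qmin] := @Zorn T le_T.
- by move=> q; apply/asboolP.
- move=> /asboolP h12 /asboolP h23; apply/asboolP => x.
  exact: le_trans (h23 x) (h12 x).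
- move=> /asboolP /= h12 /asboolP /= h21; apply: eq_exist.
  by apply/funext => x; apply/eqP; rewrite eq_le h12 h21.
(* The empty chain is bounded by [p] itself, as an infimum over the empty set is a mere default
   value. *)
- have [[q0 Cq0]|C0] := pselect (C !=set0); last first.
    exists (exist _ p (conj ps (fun x => lexx _))) => s Cs.
    by case: C0; exists s.
  pose E x := [set r | exists2 q : T, C q & r = sval q x].
  pose g x := inf (E x).
  have g_le (q : T) x : C q -> g x <= sval q x.
    move=> Cq; apply: ge_inf; last by exists q.
    exists (- p (- x)) => _ [[r [rs rp]] _ ->] /=.
    by apply: le_trans (sublinearN _ rs); rewrite lerN2.
  have g_ge m x : (forall q : T, C q -> m <= sval q x) -> m <= g x.
    move=> h; apply: lb_le_inf; first by exists (sval q0 x), q0.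
    by move=> _ [q Cq ->]; exact: h.
  have gs : sublinear g.
    split=> [x y|t x t0].
      rewrite -lerBlDr; apply: (g_ge _ _) => q1 C1.
      rewrite lerBlDr -lerBlDl; apply: (g_ge _ _) => q2 C2.
      rewrite lerBlDl.
      (* The smaller of [q1] and [q2] bounds [g (x + y)]; replacing it by the larger at one of the
         two points only weakens the bound. *)
      have [/asboolP h|/asboolP h] := Ctot _ _ C1 C2.
        apply: le_trans (g_le _ _ C2) _; apply: le_trans ((svalP q2).1.1 _ _) _.
        by rewrite lerD2r.
      apply: le_trans (g_le _ _ C1) _; apply: le_trans ((svalP q1).1.1 _ _) _.
      by rewrite lerD2l.
    rewrite -ler_pdivrMl//; apply: (g_ge _ _) => q Cq; rewrite ler_pdivrMl//.
    by apply: le_trans (g_le _ _ Cq) _; exact: (svalP q).1.2.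
  have gp x : g x <= p x by apply: le_trans (g_le _ _ Cq0) _; exact: (svalP q0).2.
  by exists (exist _ g (conj gs gp)) => q Cq; apply/asboolP => x; exact: g_le.
- exists q => //; apply: minimal_sublinear_linear => // r rs rq.
  have rp x : r x <= p x by exact: le_trans (rq x) (qp x).
  have := qmin (exist _ r (conj rs rp)); rewrite /le_T/=.
  by move=> /(_ (asboolT rq)) [].
Qed.

End Sublinear.

(** * Arithmetic of the algebra, its involution and its norm *)

Section CStarAlgebra.
Context {R : realType} {A : lmodType R[i]}.
Context {mul : A -> A -> A} {star : A -> A} {nA : A -> R}.
Hypothesis HA : is_cstar_algebra mul star nA.
Implicit Types (a b d e h : A) (c z : R[i]) (r s t : R).
Local Notation "t *:r x" := (real_complex R t *: x) (at level 40).
Local Notation iC := (Complex 0 1 : R[i]).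

Lemma cmulDl a b d : mul (a + b) d = mul a d + mul b d.
Proof. by have := mul_linl HA 1 a b d; rewrite !scale1r. Qed.

Lemma cmulDr a b d : mul d (a + b) = mul d a + mul d b.
Proof. by have := mul_linr HA 1 a b d; rewrite !scale1r. Qed.

Lemma cmul0l d : mul 0 d = 0.
Proof. by apply: (addrI (mul 0 d)); rewrite -cmulDl !addr0. Qed.

Lemma cmul0r d : mul d 0 = 0.
Proof. by apply: (addrI (mul d 0)); rewrite -cmulDr !addr0. Qed.

Lemma cmulZl c a d : mul (c *: a) d = c *: mul a d.
Proof. by have := mul_linl HA c a 0 d; rewrite cmul0l !addr0. Qed.

Lemma cmulZr c a d : mul d (c *: a) = c *: mul d a.
Proof. by have := mul_linr HA c a 0 d; rewrite cmul0r !addr0. Qed.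

Lemma cmulNr a d : mul d (- a) = - mul d a.
Proof. by rewrite -[- a]scaleN1r cmulZr scaleN1r. Qed.

Lemma cstarD a b : star (a + b) = star a + star b.
Proof. by have := star_semilin HA 1 a b; rewrite !scale1r conjc1 scale1r. Qed.

Lemma cstar0 : star 0 = 0.
Proof. by apply: (addrI (star 0)); rewrite -cstarD !addr0. Qed.

Lemma cstarZ c a : star (c *: a) = conjc c *: star a.
Proof. by have := star_semilin HA c a 0; rewrite cstar0 !addr0. Qed.

Lemma cstarZr t a : star (t *:r a) = t *:r star a.
Proof. by rewrite cstarZ conjc_real. Qed.

Lemma cstarN a : star (- a) = - star a.
Proof. by apply/eqP; rewrite -addr_eq0 -cstarD addNr cstar0. Qed.

Lemma normc_real t : Normc.normc (real_complex R t) = `|t|.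
Proof. by rewrite /= expr0n addr0 sqrtr_sqr. Qed.

Lemma normc_i : Normc.normc iC = 1.
Proof. by rewrite /= expr0n add0r expr1n sqrtr1. Qed.

Lemma cnormZ t a : 0 <= t -> nA (t *:r a) = t * nA a.
Proof. by move=> t0; rewrite (nA_scale HA) normc_real ger0_norm. Qed.

Lemma cnorm0 : nA 0 = 0.
Proof. by rewrite -[X in nA X](real_scale0 0) cnormZ// mul0r. Qed.

Lemma cnormN a : nA (- a) = nA a.
Proof.
by rewrite -[in LHS](real_scale1 a) -real_scaleN (nA_scale HA) normc_real normrN1 mul1r.
Qed.

Lemma cnormB_le a b : nA (a - b) <= nA a + nA b.
Proof. by rewrite -(cnormN b); exact: nA_triangle HA _ _. Qed.

Lemma cnorm_gt0 a : a != 0 -> 0 < nA a.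
Proof.
move=> a0; rewrite lt_neqAle (nA_ge0 HA) andbT eq_sym.
by apply: contra a0 => /eqP/(nA_eq0 HA)/eqP.
Qed.

Lemma cnorm_star_le a : nA a <= nA (star a).
Proof.
have [->|a0] := eqVneq a 0; first by rewrite cnorm0 (nA_ge0 HA).
by rewrite -(ler_pM2r (cnorm_gt0 a0)) -expr2 -(nA_cstar HA) (nA_submul HA).
Qed.

Lemma cnorm_star a : nA (star a) = nA a.
Proof.
apply/eqP; rewrite eq_le cnorm_star_le andbT.
by have := cnorm_star_le (star a); rewrite (star_invol HA).
Qed.

(** * Norm estimates for selfadjoint operators on [A] *)

Definition selfadjoint (u : A -> A) :=
  forall d e, mul (star (u d)) e = mul (star d) (u e).

Lemma selfadjoint_comp (u : A -> A) : selfadjoint u -> selfadjoint (u \o u).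
Proof. by move=> us d e /=; rewrite !us. Qed.

(** Cauchy-Schwarz for the inner product [mul (star d) e], which makes [A] a Hilbert module over
    itself and [u] selfadjoint in the usual sense. *)
Lemma selfadjoint_sqr_norm (u : A -> A) d : selfadjoint u ->
  nA (u d) ^+ 2 <= nA d * nA (u (u d)).
Proof.
by move=> us; rewrite -(nA_cstar HA) us -[in leRHS](cnorm_star d) (nA_submul HA).
Qed.

(** For purely imaginary [z] the cross terms in [mul (star (d + z *: u d)) (d + z *: u d)] cancel,
    so it depends only on [z ^+ 2], which is the same for [iC] and [- iC]. *)
Lemma selfadjoint_rotate (u : {linear A -> A}) d : selfadjoint u ->
  nA (d + iC *: u d) = nA (d - iC *: u d).
Proof.
move=> us.
have sqr z : conjc z = - z -> mul (star (d + z *: u d)) (d + z *: u d) =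
    mul (star d) d - z ^+ 2 *: mul (star (u d)) (u d).
  move=> zN; rewrite cstarD cstarZ zN cmulDl !cmulDr !cmulZl !cmulZr us.
  by rewrite scalerA mulNr scaleNr addrA scaleNr -expr2 addrK.
have ci : conjc iC = - iC by apply/eqP; rewrite eq_complex /= oppr0 !eqxx.
apply/eqP; rewrite -(eqrXn2 (_ : 0 < 2)%N) ?(nA_ge0 HA)// -scaleNr.
rewrite -!(nA_cstar HA) !sqr ?sqrrN//; by rewrite -[in RHS]ci raddfN.
Qed.

(* [(1 + iu)^2 = 1 - u^2 + 2iu] and [(1 - iu)^2 = 1 - u^2 - 2iu] both have the
   same modulus as [(1 - iu)(1 + iu) = 1 + u^2]. *)
Lemma selfadjoint_add_sqr (u : {linear A -> A}) d : selfadjoint u ->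
  nA d <= nA (d + u (u d)) /\ 2 * nA (u d) <= nA (d + u (u d)).
Proof.
move=> us.
have ii : iC * iC = -1 by rewrite -expr2; exact: sqr_i.
have h1 : nA (d - u (u d) + iC *: (u d + u d)) = nA (d + u (u d)).
  have := selfadjoint_rotate (d + iC *: u d) us.
  rewrite linearD linearZ/= !scalerDr scalerA ii scaleN1r.
  rewrite opprD opprK addrA.
  have -> : d + iC *: u d + iC *: u d - u (u d) =
    d - u (u d) + (iC *: u d + iC *: u d) by rewrite addrA (addrAC d (- _)) [RHS]addrAC.
  move=> ->; by rewrite addrA addrK.
have h2 : nA (d - u (u d) - iC *: (u d + u d)) = nA (d + u (u d)).
  have := selfadjoint_rotate (d - iC *: u d) us.
  rewrite linearB [u (iC *: _)]linearZ/= !scalerDr !scalerN scalerA ii scaleN1r opprK.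
  rewrite addrA subrK => ->; congr nA.
  by rewrite !opprD -!addrA; congr (_ + _); rewrite addrC -!addrA.
(* [p] and [q] are half the sum and half the difference of two vectors of norm [nA (d + u (u d))],
   so neither exceeds that norm. Moreover [q] has norm [2 * nA (u d)], and [p] plus [d + u (u d)] is
   twice [d]. *)
set p := d - u (u d) in h1 h2; set q := iC *: (u d + u d) in h1 h2.
have nq : nA (q + q) = 4 * nA (u d).
  rewrite -scalerDr (nA_scale HA) normc_i mul1r.
  have -> : u d + u d + (u d + u d) = 4 *:r u d.
    by rewrite rmorph_nat scaler_nat !mulrS addr0 !addrA.
  by rewrite cnormZ.
have np : nA (p + p) = 2 * nA p.
  have -> : p + p = 2 *:r p by rewrite rmorph_nat scaler_nat mulr2n.
  by rewrite cnormZ.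
have nd : nA (d + u (u d) + p) = 2 * nA d.
  have -> : d + u (u d) + p = 2 *:r d.
    by rewrite rmorph_nat scaler_nat mulr2n /p addrACA subrr addr0.
  by rewrite cnormZ.
split.
  have : nA (p + p) <= nA (p + q) + nA (p - q).
    by rewrite -[p + p](_ : (p + q) + (p - q) = _) ?(nA_triangle HA)// addrACA subrr addr0.
  have := nA_triangle HA (d + u (u d)) p.
  lra.
have : nA (q + q) <= nA (p + q) + nA (p - q).
  have -> : q + q = (p + q) - (p - q) by rewrite opprB [RHS]addrC addrA subrK.
  exact: cnormB_le.
lra.
Qed.

Lemma iter_comp (u : A -> A) n d : iter n (u \o u) d = iter (n + n) u d.
Proof. by elim: n d => // n IH d; rewrite addnS addSn !iterSr IH. Qed.

(** The induction passes to [u \o u]. As 1 - u^4 = (1 + u^2)(1 - u^2), the doubling inequality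
    trades the factor 1 + u^2 for a factor 2 and one more [u], whence the exponent 2k - 1 = 2(k - 1)
    + 1. *)
Lemma selfadjoint_dyadic n (u : {linear A -> A}) d : selfadjoint u ->
  2 ^+ n * nA (iter (2 ^ n).-1 u (d - u (u d))) <= nA (d - iter (2 ^ n + 2 ^ n) u d).
Proof.
elim: n u d => [|n IH] u d us; first by rewrite mul1r.
have := IH (u \o u) d (selfadjoint_comp us).
rewrite !iter_comp /= => IHu; rewrite expnS mul2n -addnn.
apply: le_trans IHu; rewrite exprSr -mulrA ler_pM2l ?exprn_gt0//.
set k := (2 ^ n)%N in IH *; set e := d - u (u d).
have k0 : (0 < k)%N by rewrite expn_gt0.
have -> : (k + k).-1 = ((k.-1 + k.-1).+1)%N by rewrite -[in LHS](prednK k0) addSn addnS.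
have itD m (x y : A) : iter m u (x + y) = iter m u x + iter m u y.
  by elim: m => //= m ->; rewrite linearD.
have -> : d - u (u (u (u d))) = e + u (u e).
  by rewrite /e !linearB addrA subrK.
clearbody e; rewrite itD -!iterSr /=; exact: (selfadjoint_add_sqr (iter (k.-1 + k.-1) u e) us).2.
Qed.

(** Iterated Cauchy-Schwarz. It turns a bound on a high power of [u] into a bound on [u] itself. *)
Lemma selfadjoint_pow_le n (u : {linear A -> A}) d : selfadjoint u ->
  nA (u d) ^+ (2 ^ n) * nA d <= nA d ^+ (2 ^ n) * nA (iter (2 ^ n) u d).
Proof.
elim: n u => [|n IH] u us; first by rewrite !expr1 mulrC.
have := IH (u \o u) (selfadjoint_comp us).
rewrite iter_comp expnS mul2n -addnn /= => IHu.
have le1 := lerXn2r (2 ^ n) _ _ (selfadjoint_sqr_norm d us).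
rewrite -exprM mul2n -addnn exprMn in le1.
have {}le1 := le1 (exprn_ge0 _ (nA_ge0 HA _)) (mulr_ge0 (nA_ge0 HA _) (nA_ge0 HA _)).
apply: le_trans (ler_wpM2r (nA_ge0 HA d) le1) _.
by rewrite exprD -!mulrA ler_wpM2l// exprn_ge0// (nA_ge0 HA).
Qed.

Lemma bernoulli_le t n : 0 <= t <= 1 -> 1 - t *+ n <= (1 - t) ^+ n.
Proof.
move=> /andP[t0 t1]; elim: n => [|n IH]; first by rewrite mulr0n subr0 expr0.
rewrite exprS; apply: le_trans (ler_wpM2l _ IH); last by lra.
have : 0 <= t * (t *+ n) by rewrite mulr_ge0// mulrn_wge0.
rewrite mulrS; lra.
Qed.

Lemma selfadjoint_contraction_lt (u : {linear A -> A}) r : selfadjoint u ->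
  (forall d, nA (u d) <= nA d) -> 0 < r ->
  (forall d, r * nA d <= nA (d - u (u d))) ->
  exists2 s, 0 <= s < 1 & forall d, nA (u d) <= s * nA d.
Proof.
move=> us ule r0 ur.
(* With 4 here, the dyadic inequality has left side at least [4 * nA e] and right side at most
   [2 * nA d], which gives [half]. *)
have [n n_gt] : exists n, 4 <= 2 ^+ n * r.
  by exists (Num.bound (4 / r)); rewrite -ler_pdivrMr// ltW// upper_nthrootP.
have iterle k d : nA (iter k u d) <= nA d.
  by elim: k => //= k IH; exact: le_trans (ule _) IH.
have half d : 2 * nA (iter (2 ^ n) u d) <= nA d.
  have := selfadjoint_dyadic n d us.
  have -> : iter (2 ^ n).-1 u (d - u (u d)) =
      iter (2 ^ n).-1 u d - u (u (iter (2 ^ n).-1 u d)).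
    by elim: (_.-1) => //= k ->; rewrite !linearB.
  set e := iter _.-1 u d => h1.
  have h2 := cnormB_le d (iter (2 ^ n + 2 ^ n) u d).
  have h3 := iterle (2 ^ n + 2 ^ n)%N d.
  have h4 : nA (iter (2 ^ n) u d) <= nA e.
    by rewrite -(prednK (_ : 0 < 2 ^ n)%N) ?expn_gt0//= /e ule.
  have h5 := ler_wpM2l (exprn_ge0 n (ler0n R 2)) (ur e).
  have h6 := ler_wpM2r (nA_ge0 HA e) n_gt.
  rewrite -mulrA in h6; lra.
(* With k = 2^n, Bernoulli gives (1 - 1/(2k))^k >= 1/2, the factor in [half]. *)
exists (1 - ((2 ^ n)%N%:R *+ 2)^-1) => [|d].
  have h : 1 <= ((2 ^ n)%N%:R *+ 2 : R) by rewrite -mulrnA ler1n muln_gt0 expn_gt0.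
  have h0 := lt_le_trans ltr01 h.
  by rewrite subr_ge0 invf_le1// h gtrBl invr_gt0.
have [->|d0] := eqVneq d 0; first by rewrite linear0 cnorm0 mulr0.
have nd := cnorm_gt0 d0.
set k := (2 ^ n)%N in half *.
have k0 : (0 < k)%N by rewrite expn_gt0.
have h : 1 <= (k%:R *+ 2 : R) by rewrite -mulrnA ler1n muln_gt0 k0.
have h0 := lt_le_trans ltr01 h.
have s0 : 0 <= 1 - (k%:R *+ 2 : R)^-1 by rewrite subr_ge0 invf_le1.
rewrite -(@ler_pXn2r _ k)// ?nnegrE ?mulr_ge0 ?(nA_ge0 HA)//.
have hb : (k%:R *+ 2 : R)^-1 *+ k = 2^-1.
  rewrite -[LHS]mulr_natr -[k%:R *+ 2]mulr_natr invfM mulrAC mulVf ?mul1r//.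
  by rewrite pnatr_eq0 -lt0n.
have t01 : 0 <= (k%:R *+ 2 : R)^-1 <= 1 by rewrite invr_ge0 (ltW h0) invf_le1.
have := bernoulli_le k t01; rewrite hb => hk.
have nk : 0 < nA d ^+ k by rewrite exprn_gt0.
rewrite exprMn -(ler_pM2r nd).
apply: le_trans (selfadjoint_pow_le n d us) _; rewrite -/k.
rewrite mulrAC mulrC ler_pM2r// -(ler_pM2l (ltr0n R 2)).
apply: le_trans (half d) _; rewrite mulrA -[leLHS]mul1r ler_pM2r//; lra.
Qed.

(** The operator norm is [inf E], finite by the bound [m]. If it exceeded [r], dividing [u] by it
    would give a contraction with a gap, hence of norm below 1, contradicting the infimum. *)
Lemma selfadjoint_norm_le (u : {linear A -> A}) r m : 0 <= r -> selfadjoint u ->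
  (forall d, nA (u d) <= m * nA d) ->
  (forall q, r < q -> exists2 s, 0 < s &
    forall d, s * nA d <= nA (q ^+ 2 *:r d - u (u d))) ->
  forall d, nA (u d) <= r * nA d.
Proof.
move=> r0 us um ugap.
pose E := [set t | 0 <= t /\ forall d, nA (u d) <= t * nA d].
have Elb : has_lbound E by exists 0 => t [].
have E0 : E !=set0.
  exists `|m|; split=> // d; apply: le_trans (um d) _.
  by rewrite ler_wpM2r ?ler_norm ?(nA_ge0 HA).
have qub d : nA (u d) <= inf E * nA d.
  have [->|d0] := eqVneq d 0; first by rewrite linear0 cnorm0 mulr0.
  rewrite -ler_pdivrMr ?cnorm_gt0//; apply: lb_le_inf => // t [t0 ut].
  by rewrite ler_pdivrMr ?cnorm_gt0.
have [qr|rq] := leP (inf E) r.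
  by move=> d; apply: le_trans (qub d) _; rewrite ler_wpM2r// (nA_ge0 HA).
exfalso; move: qub rq; set q := inf E => qub rq.
have q0 : 0 < q by exact: le_lt_trans rq.
have [s s0 us_gap] := ugap q rq.
pose w : {linear A -> A} := real_complex R q^-1 \*: u.
have wE d : w d = q^-1 *:r u d by [].
have qi0 : 0 < q^-1 by rewrite invr_gt0.
have ws : selfadjoint w by move=> d e; rewrite !wE cstarZr cmulZl cmulZr us.
have wle d : nA (w d) <= nA d.
  by rewrite wE (cnormZ _ (ltW qi0)) ler_pdivrMl.
have w_gap d : s / q ^+ 2 * nA d <= nA (d - w (w d)).
  have -> : d - w (w d) = (q ^+ 2)^-1 *:r (q ^+ 2 *:r d - u (u d)).
    rewrite !wE [u (_ *: _)]linearZ/= real_scaleA -invfM -expr2 scalerBr real_scaleA.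
    by rewrite mulVf ?expf_neq0 ?gt_eqF// real_scale1.
  have q2 : 0 <= (q ^+ 2)^-1 by rewrite invr_ge0 exprn_ge0// ltW.
  by rewrite cnormZ// mulrAC mulrC ler_wpM2l.
have sq0 : 0 < s / q ^+ 2 by rewrite divr_gt0// exprn_gt0.
have [t /andP[t0 t1] wt] := selfadjoint_contraction_lt ws wle sq0 w_gap.
have : q <= t * q.
  apply: ge_inf => //; split=> [|d]; first by rewrite mulr_ge0// ltW.
  have := wt d; rewrite wE (cnormZ _ (ltW qi0)) ler_pdivrMl// => h.
  by rewrite [t * q]mulrC -mulrA.
by rewrite ler_pMl// leNgt t1.
Qed.

(** * Positivity through left multiplication *)

(* Equivalent to [0 <= a], phrased as [norm (a - norm a / 2) <= norm a / 2] in the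
   multiplier norm so that no unitization is needed. *)
Definition half_ball a :=
  star a = a /\ forall d, nA (2 *:r mul a d - nA a *:r d) <= nA a * nA d.

(** For u = 2a - m with m the norm of [a], factor q^2 - u^2 = (q - u)(q + u). The factor q + u = 2(a
    + (q - m)/2) is bounded below by the gap, and q - u = (q + m) - 2a is bounded below by q - m. *)
Lemma half_ball_of_gap a : star a = a ->
  (forall s, 0 < s -> exists2 r, 0 < r &
    forall d, r * nA d <= nA (mul a d + s *:r d)) ->
  half_ball a.
Proof.
move=> sa gap; split=> // d.
pose m := nA a; have m0 : 0 <= m by exact: nA_ge0 HA _.
pose w d := 2 *:r mul a d - m *:r d.
have wl : linear w.
  move=> c x y; rewrite /w cmulDr cmulZr !scalerDr opprD addrACA.
  by congr (_ + _); rewrite scalerN !scalerA ![_ * c]mulrC.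
pose u : {linear A -> A} := HB.pack w (GRing.isLinear.Build _ _ _ _ w wl).
have uE x : u x = w x by [].
have us : selfadjoint u.
  move=> x y; rewrite !uE /w cstarD cstarN !cstarZr (star_mul HA) sa.
  by rewrite cmulDl cmulDr -scaleNr cmulNr !cmulZl !cmulZr -(mul_assoc HA) scaleNr.
rewrite -/(w d) -uE; clearbody u.
have le2 x : nA (2 *:r mul a x) <= 2 * (m * nA x).
  by rewrite cnormZ// ler_wpM2l// (nA_submul HA).
rewrite -/m; apply: (@selfadjoint_norm_le u m (3 * m)) => //.
  move=> x; rewrite uE; apply: le_trans (cnormB_le _ _) _; rewrite (cnormZ _ m0).
  have := le2 x; lra.
move=> q mq.
have s0 : 0 < (q - m) / 2 by lra.
have [r r0 hr] := gap _ s0.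
exists ((q - m) * (2 * r)) => [|x]; first by apply: mulr_gt0; lra.
set e := 2 *:r (mul a x + ((q - m) / 2) *:r x).
have eE : e = q *:r x + u x.
  rewrite /e uE /w scalerDr real_scaleA.
  have -> : 2 * ((q - m) / 2) = q - m by lra.
  by rewrite real_scaleDl real_scaleN addrCA.
have -> : q ^+ 2 *:r x - u (u x) = q *:r e - u e.
  rewrite eE [u (_ + _)]linearD [u (_ *: _)]linearZ/= scalerDr real_scaleA -expr2.
  by rewrite opprD addrA addrK.
have he : 2 * r * nA x <= nA e by rewrite cnormZ// -mulrA ler_wpM2l.
have h : (q - m) * nA e <= nA (q *:r e - u e).
  have := nA_triangle HA (q *:r e - u e) (2 *:r mul a e).
  rewrite uE /w opprB addrA subrK -real_scaleDl cnormZ; last by lra.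
  have := le2 e; lra.
by apply: le_trans h; rewrite -mulrA ler_wpM2l//; lra.
Qed.

(** h^2 + s = s (1 + u^2) for u = h / sqrt s, and 1 + u^2 does not shrink norms. *)
Lemma half_ball_sqr h : star h = h -> half_ball (mul h h).
Proof.
move=> sh; apply: half_ball_of_gap; first by rewrite (star_mul HA) sh.
move=> s s0; exists s => // d.
pose t := Num.sqrt s; have t0 : 0 < t by rewrite sqrtr_gt0.
have t2 : t * t = s by rewrite -expr2 sqr_sqrtr ?ltW.
pose w d := t^-1 *:r mul h d.
have wl : linear w.
  by move=> c x y; rewrite /w cmulDr cmulZr scalerDr !scalerA [_ * c]mulrC.
pose u : {linear A -> A} := HB.pack w (GRing.isLinear.Build _ _ _ _ w wl).
have uE x : u x = w x by [].
have us : selfadjoint u.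
  by move=> x y; rewrite !uE /w cstarZr (star_mul HA) sh cmulZl cmulZr (mul_assoc HA).
have -> : mul (mul h h) d + s *:r d = s *:r (d + u (u d)).
  rewrite !uE /w cmulZr real_scaleA -invfM t2 scalerDr real_scaleA divff ?gt_eqF//.
  by rewrite real_scale1 addrC (mul_assoc HA).
by rewrite cnormZ ?ler_wpM2l ?(selfadjoint_add_sqr d us).1// ltW.
Qed.

(** Since -s is outside the spectrum, 1 + a/s has a left inverse 1 - b, so it shrinks norms by at
    most the factor [1 + nA b]. *)
Lemma half_ball_pos a : cstar_positive mul star a -> half_ball a.
Proof.
move=> [sa spa]; apply: half_ball_of_gap => // s s0.
pose l : R[i] := real_complex R (- s).
have l0 : l != 0 by rewrite fmorph_eq0 oppr_eq0 gt_eqF.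
have [[b [_ hb]]|nq] := pselect (quasi_invertible mul (l^-1 *: a)); last first.
  have : in_spectrum mul a l by right.
  by move=> /spa; rewrite lecR oppr_ge0 leNgt s0.
have b1 : 0 < 1 + nA b by rewrite ltr_pwDl// (nA_ge0 HA).
exists (s / (1 + nA b)) => [|d]; first exact: divr_gt0.
rewrite mulrAC ler_pdivrMr//.
pose e := d - l^-1 *: mul a d.
have -> : mul a d + s *:r d = s *:r e.
  rewrite /e scalerBr scalerA /l rmorphN invrN mulrN divff ?fmorph_eq0 ?gt_eqF//.
  by rewrite scaleN1r opprK addrC.
rewrite (cnormZ _ (ltW s0)) -mulrA ler_pM2l//.
have -> : d = e - mul b e.
  have := congr1 (mul^~ d) hb; rewrite /= cmul0l !cmulDl -scaleN1r !cmulZl scaleN1r.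
  rewrite -(mul_assoc HA) cmulZl /e cmulDr cmulNr.
  set x := l^-1 *: mul a d; set y := mul b d; set z := mul b x => hz.
  by rewrite -addrA -opprD addrA hz subr0.
apply: le_trans (cnormB_le _ _) _.
by rewrite mulrDr mulr1 [nA e * _]mulrC lerD2l (nA_submul HA).
Qed.

(** * Construction of norming states *)

Lemma cnorm_sublinear : sublinear nA.
Proof. by split=> [x y|t x t0]; [exact: nA_triangle HA _ _|rewrite cnormZ// ltW]. Qed.

(** This makes functionals below [tilt nA a] nonnegative at [h]. The element splits into a multiple
    of 2a - |a| of norm at most |h|, and half of 2h - |h| - |h|, again of norm at most |h|. *)
Lemma half_ball_sub_le a h : half_ball a -> half_ball h -> a != 0 ->
  nA (- h + (2 * nA h / nA a) *:r a) <= 2 * nA h.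
Proof.
move=> [sa ha] [sh hh] /cnorm_gt0 m0; set k := - h + _.
have sk : star k = k by rewrite cstarD cstarN cstarZr sa sh.
have kle d : nA (mul k d) <= 2 * nA h * nA d.
  have -> : mul k d = (nA h / nA a) *:r (2 *:r mul a d - nA a *:r d) -
      2^-1 *:r (2 *:r mul h d - nA h *:r d - nA h *:r d).
    rewrite cmulDl cmulZl -[- h]scaleN1r cmulZl scaleN1r.
    rewrite !scalerBr !real_scaleA mulVf ?pnatr_eq0// real_scale1 divfK ?gt_eqF//.
    have -> : nA h / nA a * 2 = 2 * nA h / nA a by rewrite mulrAC [nA h * _]mulrC.
    rewrite -[_ - _ - _ in X in _ - X]addrA -opprD -real_scaleDl.
    have -> : 2^-1 * nA h + 2^-1 * nA h = nA h by lra.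
    by rewrite opprB addrA subrK addrC.
  apply: le_trans (cnormB_le _ _) _.
  have c0 : 0 <= nA h / nA a by rewrite divr_ge0// ?(nA_ge0 HA).
  rewrite !cnormZ ?invr_ge0//.
  have := ler_wpM2l c0 (ha d); rewrite mulrA divfK ?gt_eqF// => h1.
  have := cnormB_le (2 *:r mul h d - nA h *:r d) (nA h *:r d).
  rewrite (cnormZ d (nA_ge0 HA h)); have := hh d; lra.
have [k0|k0] := eqVneq k 0; first by rewrite k0 cnorm0 mulr_ge0// (nA_ge0 HA).
(* The multiplier bound at [d = k] becomes a norm bound by the C*-identity. *)
by rewrite -(ler_pM2r (cnorm_gt0 k0)) -expr2 -(nA_cstar HA) sk.
Qed.

Lemma functional_norm_eq1 (phi : A -> R[i]) a : linear_functional phi ->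
  (forall d, Normc.normc (phi d) <= nA d) -> a != 0 -> phi a = real_complex R (nA a) ->
  functional_norm nA phi = 1.
Proof.
move=> phil phile /cnorm_gt0 a0 phia; apply/eqP; rewrite eq_le; apply/andP; split.
  apply: sup_le_ub; first by exists (Normc.normc (phi 0)), 0; rewrite cnorm0.
  by move=> _ [d [d1 ->]]; exact: le_trans (phile d) d1.
apply: ub_le_sup; first by exists 1 => _ [d [d1 ->]]; exact: le_trans (phile d) d1.
have phi0 : phi 0 = 0.
  by have := phil (-1) 0 0; rewrite scaler0 addr0 mulN1r addNr.
exists ((nA a)^-1 *:r a); rewrite cnormZ ?invr_ge0 ?(ltW a0)// mulVf ?gt_eqF//; split=> //.
by rewrite -[_ *: a]addr0 phil phi0 addr0 phia -rmorphM mulVf ?gt_eqF// normc_real normr1.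
Qed.

Definition complexify (g : A -> R) d : R[i] := Complex (g d) (- g (iC *: d)).

Lemma scale_Complex r s d : Complex r s *: d = r *:r d + s *:r (iC *: d).
Proof.
rewrite scalerA -scalerDl; congr (_ *: _).
by apply/eqP; rewrite eq_complex /= !mul0r !mulr0 !mulr1 subrr addr0 !add0r addr0 !eqxx.
Qed.

Lemma complexify_linear g : real_linear g -> linear_functional (complexify g).
Proof.
move=> [gD gZ] [r s] a b; rewrite /complexify scalerDr [iC *: (_ *: a)]scalerA mulrC -scalerA.
rewrite !(scale_Complex r s) [iC *: (iC *: _)]scalerA (_ : iC * iC = -1); last exact: (sqr_i R).
rewrite !gD !gZ scaleN1r real_linearN//.
by apply/eqP; rewrite eq_complex /=; apply/andP; split; apply/eqP; lra.
Qed.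

(** Multiply [d] by the conjugate z of its image: [g (z *: d)] is the squared modulus of the image,
    so one factor cancels. *)
Lemma complexify_le g d : real_linear g -> (forall a, g a <= nA a) ->
  Normc.normc (complexify g d) <= nA d.
Proof.
move=> gl gle; rewrite /= sqrrN.
set s := g d; set t := g (iC *: d).
have := gle (Complex s t *: d); rewrite (nA_scale HA) scale_Complex gl.1 !gl.2 /=.
rewrite -/s -/t -!expr2 => h.
have [n0|n0] := leP (Num.sqrt (s ^+ 2 + t ^+ 2)) 0.
  by apply: le_trans n0 _; exact: nA_ge0 HA _.
by rewrite -(ler_pM2l n0) -expr2 sqr_sqrtr ?addr_ge0 ?sqr_ge0.
Qed.

Lemma exists_norming_state a b : half_ball a -> a != 0 -> star b = b ->
  exists phi, [/\ is_state mul star nA phi, phi a = real_complex R (nA a) &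
    complex.Re (phi b) = tilt nA a b].
Proof.
move=> ha a0 sb; have m0 := cnorm_gt0 a0.
(* Tilting first along [a] and then along [b] forces equality at both vectors. *)
have Ns := cnorm_sublinear; have ts := tilt_sublinear a Ns.
have [f fl fle] := exists_linear_le (tilt_sublinear b ts).
have fb : f b = tilt nA a b by exact: le_tilt_linear fle.
have {}fle d : f d <= tilt nA a d := le_trans (fle d) (tilt_le_self _ _ ts).
have fa : f a = nA a by exact: le_tilt_linear fle.
have fN d : f d <= nA d := le_trans (fle d) (tilt_le_self _ _ Ns).
have fpos h : half_ball h -> 0 <= f h.
  (* This tilt parameter gives [f (- h) <= 2 * nA h - 2 * nA h]. *)
  move=> hh; have s0 : 0 <= 2 * nA h / nA a.
    by rewrite divr_ge0 ?mulr_ge0// (nA_ge0 HA).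
  have := le_trans (fle (- h)) (tilt_le a (- h) Ns s0).
  have := half_ball_sub_le ha hh a0.
  rewrite real_linearN// divfK ?gt_eqF//; lra.
(* Averaging with the adjoint kills [g] on [iC] times selfadjoint elements, so the complexification
   is real on selfadjoint ones. *)
pose g d := f (2^-1 *:r (d + star d)).
have gl : real_linear g.
  split=> [x y|t x]; rewrite /g; first by rewrite -fl.1 -scalerDr cstarD addrACA.
  by rewrite cstarZr -scalerDr real_scaleA mulrC -real_scaleA fl.2.
have g_self d : star d = d -> g d = f d.
  move=> sd; rewrite /g sd; congr f.
  by rewrite scalerDr -real_scaleDl -[RHS]real_scale1; congr (_ *:r _); lra.
have gi_self d : star d = d -> g (iC *: d) = 0.
  move=> sd; rewrite /g cstarZ sd -scalerDl (_ : iC + conjc iC = 0).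
    by rewrite scale0r scaler0 -(real_scale0 0) fl.2 mul0r.
  by apply/eqP; rewrite eq_complex /= addr0 subrr !eqxx.
have gN d : g d <= nA d.
  apply: le_trans (fN _) _; rewrite cnormZ ?invr_ge0// ler_pdivrMl//.
  by apply: le_trans (nA_triangle HA _ _) _; rewrite cnorm_star; lra.
have phiE d : star d = d -> complexify g d = real_complex R (f d).
  by move=> sd; rewrite /complexify g_self// gi_self// oppr0.
have phia : complexify g a = real_complex R (nA a) by rewrite phiE ?fa// ha.1.
exists (complexify g); split=> //; last by rewrite phiE.
split; last first.
  apply: functional_norm_eq1 phia => //; first exact: complexify_linear.
  by move=> d; exact: complexify_le.
split; first exact: complexify_linear.
by move=> h hp; rewrite phiE ?hp.1// lecR fpos//; exact: half_ball_pos.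
Qed.

Lemma state_norm_le (phi : A -> R[i]) d : is_state mul star nA phi ->
  Normc.normc (phi d) <= nA d.
Proof.
move=> [[phil _] phi1].
have [E0 Eub] : has_sup [set r | exists a, nA a <= 1 /\ r = Normc.normc (phi a)].
  (* An unbounded set would have the default supremum 0, contradicting the value 1. *)
  have [//|E] := pselect (has_sup [set r | exists a, nA a <= 1 /\ r = Normc.normc (phi a)]).
  move: phi1; rewrite /functional_norm sup_out// => /esym/eqP.
  by rewrite oner_eq0.
have phi0 : phi 0 = 0.
  by have := phil (-1) 0 0; rewrite scaler0 addr0 mulN1r addNr.
have [->|/cnorm_gt0 d0] := eqVneq d 0; first by rewrite phi0 Normc.normc0 (nA_ge0 HA).
have phiZ : phi ((nA d)^-1 *:r d) = real_complex R (nA d)^-1 * phi d.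
  by rewrite -[_ *: d]addr0 phil phi0 addr0.
have : Normc.normc (phi ((nA d)^-1 *:r d)) <= 1.
  rewrite -phi1; apply: ub_le_sup => //; exists ((nA d)^-1 *:r d).
  by rewrite cnormZ ?invr_ge0 ?(ltW d0)// mulVf ?gt_eqF.
by rewrite phiZ Normc.normcM normc_real ger0_norm ?invr_ge0 ?(ltW d0)// ler_pdivrMl// mulr1.
Qed.

Lemma Re_le_normc c : complex.Re c <= Normc.normc c.
Proof.
case: c => r s /=; apply: le_trans (ler_norm r) _.
by rewrite -sqrtr_sqr ler_sqrt ?addr_ge0 ?sqr_ge0// lerDl sqr_ge0.
Qed.

(** Either d + d^* is nonzero and selfadjoint, or d^* = -d and [iC *: d] is selfadjoint. Its square
    is then normed by a state. *)
Lemma exists_state : (exists a, a != 0) -> exists phi, is_state mul star nA phi.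
Proof.
move=> [d d0].
have [h sh h0] : exists2 h, star h = h & h != 0.
  have [dd|dd] := eqVneq (d + star d) 0; last first.
    by exists (d + star d) => //; rewrite cstarD (star_invol HA) addrC.
  exists (iC *: d).
    rewrite cstarZ; have -> : star d = - d by apply/eqP; rewrite -addr_eq0 addrC dd.
    rewrite scalerN -scaleNr; congr (_ *: _).
    by apply/eqP; rewrite eq_complex /= oppr0 opprK !eqxx.
  by rewrite scaler_eq0 negb_or d0 andbT eq_complex /= oner_eq0 andbF.
have hh0 : mul h h != 0.
  apply: contra h0 => /eqP hh; apply/eqP/(nA_eq0 HA)/eqP.
  by rewrite -sqrf_eq0 -(nA_cstar HA) sh hh cnorm0.
have [phi [phis _ _]] := exists_norming_state (half_ball_sqr sh) hh0 cstar0.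
by exists phi.
Qed.

(** * Difference quotients in the Hilbert module *)

Section HilbertModule.
Context {X : lmodType R[i]} {act : X -> A -> X} {ip : X -> X -> A}.
Hypothesis HX : is_hilbert_module mul star nA act ip.
Implicit Types x y : X.

Lemma ipDr x y (z : X) : ip x (y + z) = ip x y + ip x z.
Proof. by have := ip_linr HX 1 x y z; rewrite !scale1r. Qed.

Lemma ip0r x : ip x 0 = 0.
Proof. by apply: (addrI (ip x 0)); rewrite -ipDr !addr0. Qed.

Lemma ipZr c x y : ip x (c *: y) = c *: ip x y.
Proof. by have := ip_linr HX c x y 0; rewrite ip0r !addr0. Qed.

Lemma ip0l y : ip 0 y = 0.
Proof. by rewrite -(ip_star HX) ip0r cstar0. Qed.

Lemma ip_addZ c x y : ip (x + c *: y) (x + c *: y) =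
  ip x x + (c *: ip x y + conjc c *: ip y x) + (c * conjc c) *: ip y y.
Proof.
have ipDl (z : X) : ip (x + c *: y) z = ip x z + conjc c *: ip y z.
  by rewrite addrC (ip_semilinl HX) addrC.
rewrite ipDr ipZr !ipDl scalerDr scalerA [LHS]addrA.
by rewrite [c *: ip x y + _ in RHS]addrC [ip x x + _ in RHS]addrA.
Qed.

Lemma hnorm_sqr x : hnorm nA ip x ^+ 2 = nA (ip x x).
Proof. by rewrite sqr_sqrtr// (nA_ge0 HA). Qed.

Lemma hnorm_sqr_add t x y : hnorm nA ip (x + t *:r y) ^+ 2 =
  nA (ip x x + t *:r (ip x y + ip y x) + (t * t) *:r ip y y).
Proof. by rewrite hnorm_sqr ip_addZ conjc_real scalerDr -rmorphM. Qed.

(* Hermitian symmetry on inner products comes from the positivity of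
   [<x + iy, x + iy>]; no decomposition of self-adjoint elements is needed. *)
Lemma Re_functional_ip_sym (psi : A -> R[i]) x y : positive_functional mul star psi ->
  complex.Re (psi (ip y x)) = complex.Re (psi (ip x y)).
Proof.
move=> [psil psi_pos].
have Im0 (z : X) : complex.Im (psi (ip z z)) = 0.
  have := psi_pos _ (ip_pos HX z); case: (psi _) => r s.
  by rewrite lecE /= => /andP[/eqP].
have psiD a b : psi (a + b) = psi a + psi b.
  by have := psil 1 a b; rewrite scale1r mul1r.
have psi0 : psi 0 = 0 by apply: (addrI (psi 0)); rewrite -psiD !addr0.
have psiZ c a : psi (c *: a) = c * psi a.
  by have := psil c a 0; rewrite psi0 !addr0.
have := Im0 (x + iC *: y); rewrite ip_addZ !psiD !psiZ.
have := Im0 x; have := Im0 y.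
case: (psi (ip x x)) => r1 s1; case: (psi (ip y y)) => r2 s2.
case: (psi (ip x y)) => r3 s3; case: (psi (ip y x)) => r4 s4 /=; lra.
Qed.

Lemma Re_functional_ip_add (psi : A -> R[i]) x y : positive_functional mul star psi ->
  complex.Re (psi (ip x y + ip y x)) = 2 * complex.Re (psi (ip x y)).
Proof.
move=> psip; have := Re_functional_ip_sym x y psip.
have := psip.1 1 (ip x y) (ip y x); rewrite scale1r mul1r => ->.
case: (psi (ip x y)) => r1 s1; case: (psi (ip y x)) => r2 s2 /= ->; lra.
Qed.

(** In the expansion of [ip] at x + ty, [psi] attains the norm on the constant term and is
    nonnegative on the quadratic one. *)
Lemma rho_quot_ge (psi : A -> R[i]) x y t : Omega mul star nA ip x psi -> 0 < t ->
  complex.Re (psi (ip x y)) <= rho_quot nA ip x y t.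
Proof.
move=> [psis psix] t0; have [psip _] := psis; have [psil psi_pos] := psip.
rewrite /rho_quot ler_pdivlMr ?mulr_gt0// hnorm_sqr_add hnorm_sqr.
set c := ip y y; set b := ip x y + _; set a := ip x x.
have h := le_trans (Re_le_normc _) (state_norm_le (a + t *:r b + (t * t) *:r c) psis).
have hb : complex.Re (psi b) = 2 * complex.Re (psi (ip x y)) by exact: Re_functional_ip_add.
have hc : 0 <= complex.Re (psi c).
  by have := psi_pos _ (ip_pos HX y); rewrite -/c; case: (psi c) => r s; rewrite lecE => /andP[].
have ha : complex.Re (psi a) = nA a by rewrite psix /= hnorm_sqr.
have psiE : complex.Re (psi (a + t *:r b + (t * t) *:r c)) =
    complex.Re (psi a) + t * complex.Re (psi b) + t * t * complex.Re (psi c).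
  rewrite addrC psil [a + _]addrC psil.
  case: (psi a) (psi b) (psi c) => r1 s1 [r2 s2] [r3 s3] /=; lra.
have hct : 0 <= t * t * complex.Re (psi c) by rewrite !mulr_ge0// ltW.
rewrite psiE ha hb in h; lra.
Qed.

(** Write a + tb = t(b + sa) + (1 - ts)a with [s] nearly optimal for the tilt; the midpoint [m']
    leaves room for the quadratic term. *)
Lemma rho_quot_le x y m : tilt nA (ip x x) (ip x y + ip y x) < 2 * m ->
  exists2 e, 0 < e & forall t, 0 < t -> t < e -> rho_quot nA ip x y t <= m.
Proof.
set a := ip x x; set b := ip x y + _; set c := ip y y => hm.
pose m' := (tilt nA a b + 2 * m) / 2.
have [s s0 hs] : exists2 s, 0 <= s & nA (b + s *:r a) - s * nA a < m'.
  apply: contrapT => hn; suff : m' <= tilt nA a b by rewrite /m'; lra.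
  by apply: le_tilt => s s0; rewrite leNgt; apply/negP => hlt; apply: hn; exists s.
have c0 : 0 <= nA c by exact: nA_ge0 HA _.
(* [e1] keeps 1 - ts nonnegative, and [e2] keeps [t * nA c] below [2 * m - m']; adding 1 makes the
   denominators positive. *)
pose e1 := (s + 1)^-1; pose e2 := (2 * m - m') / (nA c + 1).
have e1_gt0 : 0 < e1 by rewrite invr_gt0 ltr_wpDl.
have c1 : 0 < nA c + 1 by lra.
have e2_gt0 : 0 < e2 by apply: divr_gt0 => //; rewrite /m'; lra.
exists (Num.min e1 e2) => [|t t0]; first by rewrite lt_min e1_gt0.
rewrite lt_min => /andP[te1 te2].
rewrite /rho_quot ler_pdivrMr ?mulr_gt0// hnorm_sqr_add hnorm_sqr -/a -/b -/c; clearbody a b c.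
have ts : 0 <= 1 - t * s.
  have : t * (s + 1) < 1 by rewrite -ltr_pdivlMr ?ltr_wpDl// div1r.
  lra.
have le1 : nA (a + t *:r b) <= t * nA (b + s *:r a) + (1 - t * s) * nA a.
  rewrite -(cnormZ _ (ltW t0)) -(cnormZ a ts); apply: le_trans (nA_triangle HA _ _).
  by rewrite scalerDr real_scaleA -addrA -real_scaleDl addrC addrCA subrr addr0 real_scale1.
have le2 := nA_triangle HA (a + t *:r b) ((t * t) *:r c).
rewrite (cnormZ c (mulr_ge0 (ltW t0) (ltW t0))) in le2.
have le3 : t * (nA c + 1) < 2 * m - m' by rewrite -ltr_pdivlMr.
have le4 : t * (t * (nA c + 1)) < t * (2 * m - m') by rewrite ltr_pM2l.
have le5 : t * (nA (b + s *:r a) - s * nA a) < t * m' by rewrite ltr_pM2l.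
have t2 : 0 <= t * t by rewrite mulr_ge0// ltW.
lra.
Qed.

Lemma exists_Omega_tilt x y : (exists a : A, a != 0) ->
  exists2 phi, Omega mul star nA ip x phi &
    tilt nA (ip x x) (ip x y + ip y x) <= 2 * complex.Re (phi (ip x y)).
Proof.
move=> A0; have [x0|a0] := eqVneq (ip x x) 0.
  (* Here [x = 0]: every state lies in [Omega], and the claim reduces to [tilt nA 0 0 <= 0]. *)
  have [phi phis] := exists_state A0.
  have phi0 : phi 0 = 0.
    by have := phis.1.1 (-1) 0 0; rewrite scaler0 addr0 mulN1r addNr.
  exists phi; first by split=> //; rewrite hnorm_sqr x0 phi0 cnorm0.
  rewrite (ip_def HX x0) !ip0l ip0r addr0 phi0 /= mulr0 -cnorm0.
  exact: tilt_le_self cnorm_sublinear.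
have sb : star (ip x y + ip y x) = ip x y + ip y x.
  by rewrite cstarD !(ip_star HX) addrC.
have [phi [phis phia phib]] := exists_norming_state (half_ball_pos (ip_pos HX x)) a0 sb.
exists phi; first by split=> //; rewrite hnorm_sqr.
by rewrite -phib Re_functional_ip_add//; case: phis.
Qed.

End HilbertModule.
End CStarAlgebra.

Unset Implicit Arguments.

Theorem theorem2p3 (R : realType) (A : lmodType R[i])
  (mul : A -> A -> A) (star : A -> A) (nA : A -> R)
  (HA : is_cstar_algebra mul star nA) (HAnt : exists a : A, a != 0)
  (X : lmodType R[i]) (act : X -> A -> X) (ip : X -> X -> A)
  (HX : is_hilbert_module mul star nA act ip) (x y : X) :
  exists phi : A -> R[i],
    Omega mul star nA ip x phi /\
    (forall psi, Omega mul star nA ip x psi ->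
       complex.Re (psi (ip x y)) <= complex.Re (phi (ip x y))) /\
    (rho_quot nA ip x y t @[t --> (0:R)^'+] --> complex.Re (phi (ip x y))).
Proof.
have [phi phiO phit] := exists_Omega_tilt HA HX x y HAnt.
have rho_le e : 0 < e -> exists2 d, 0 < d & forall t, 0 < t -> t < d ->
    rho_quot nA ip x y t <= complex.Re (phi (ip x y)) + e.
  by move=> e0; apply: (rho_quot_le HA HX); apply: le_lt_trans phit _; lra.
exists phi; split=> //; split=> [psi psiO|].
  apply/ler_addgt0Pr => e /rho_le[d d0 hd].
  (* Any quotient with parameter in (0, d) separates [psi] from [phi] up to [e]. *)
  apply: le_trans (hd (d / 2) _ _); [|lra|lra].
  by apply: (rho_quot_ge HA HX) => //; lra.
apply/cvgrPdist_le => e /rho_le[d d0 hd].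
near=> t.
have t0 : 0 < t by near: t; exact: nbhs_right_gt.
have td : t < d by near: t; exact: nbhs_right_lt.
have := rho_quot_ge HA HX y phiO t0; have := hd t t0 td => h1 h2.
rewrite distrC ger0_norm; lra.
Unshelve. all: end_near.
Qed.
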